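(* Let $G$ be a finite bipartite simple graph with bipartition $(X,Y)$ and let $g$ and $f$ be two integer-valued functions on $V(G)$ with $g(v)<f(v)$ for every $v\in V(G)$. Assume that for each $v\in X$, $f(v)\ge d_G(v)/2$ and $g(v)\ge f(v)/2-2$, and for each $v\in Y$, $g(v)\le d_G(v)/2$ and $f(v)\le (d_G(v)+g(v))/2+2$. Then $G$ has a factor $H$ with $g(v)\le d_H(v)\le f(v)$ for every $v\in V(G)$ if and only if $G$ has a factor $F$ such that for each $v\in V(G)$, $$d_F(v)\in\{g(v),\,g(v)+1,\,f(v)-1,\,f(v)\}.$$
   Context: A simple graph has neither loops nor multiple edges. A factor of $G$ is a spanning subgraph of $G$ (same vertex set, a subset of the edges); $d_F(v)$ and $d_G(v)$ denote the degree of $v$ in $F$ and in $G$. *)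

(* Defs.v *)
From mathcomp Require Import all_boot all_order all_algebra.
Set Implicit Arguments.
Unset Strict Implicit.
Unset Printing Implicit Defensive.

Definition simple_graph (T : finType) (e : rel T) : Prop :=
  symmetric e /\ irreflexive e.

Definition bipartition (T : finType) (e : rel T) (X Y : {set T}) : Prop :=
  [/\ X :|: Y = [set: T],
      [disjoint X & Y]
    & forall u v : T, e u v ->
        (u \in X) && (v \in Y) || (u \in Y) && (v \in X)].

(* The vertex set is the whole type, so a spanning subgraph is a subrelation. *)
Definition factor (T : finType) (e h : rel T) : Prop :=
  simple_graph h /\ subrel h e.

Definition degree (T : finType) (e : rel T) (v : T) : nat :=
  #|[set w | e v w]|.

(* Main.v *)
Require Import Defs.
From mathcomp Require Import all_boot all_order all_algebra.
From mathcomp Require Import zify.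
Import Order.TTheory GRing.Theory Num.Theory.
Local Open Scope ring_scope.

Set Implicit Arguments.
Unset Strict Implicit.
Unset Printing Implicit Defensive.

(** Orient every edge of a factor from X to Y and every other edge from Y to X.
    The factor degree becomes the out-degree on X and the in-degree on Y, and
    with (lo, hi) = (g, f) on X and (d - f, d - g) on Y the hypotheses take the
    same form d <= 2 hi, hi <= 2 lo + 4 at all vertices.  The claim is thus one
    about orientations with out-degrees in {lo, lo + 1, hi - 1, hi}.

    Give every vertex v a target window, either {lo v, lo v + 1} (low) or
    {hi v - 1, hi v} (high), and keep out-degrees above the bottom of the
    window; initially all vertices are low.  Suppose v lies above its window,
    and let S be the set of vertices reachable from v.  If some vertex of S is
    below the top of its window, reversing a path to it decreases the total
    excess.  Otherwise no arc leaves S, so the out-degrees of the vertices of S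
    and their in-degrees within S have the same sum; the numerical hypotheses
    then yield a low vertex w of S with at least hi w - 1 - out w in-neighbours
    in S.  Reversing that many of these arcs makes w a high vertex without
    increasing any excess.  So excess plus number of low vertices drops. *)

(** * Orientations and the reversal of arcs *)

Section Orientations.
Variable T : finType.
Implicit Types (e o r : rel T) (u v w x : T) (A S high : {set T}).

(** Booleans are added as numbers: an edge carries exactly one arc, a non-edge none. *)
Definition orientation e o : Prop :=
  forall u v, (o u v + o v u = e u v :> nat)%N.

Lemma degreeE r v : degree r v = (\sum_w r v w)%N.
Proof. by rewrite /degree cardsE -sum1_card big_mkcond. Qed.

Lemma orientation_irr e o : irreflexive e -> orientation e o -> irreflexive o.
Proof. by move=> irr oP u; have := oP u u; rewrite irr; case: (o u u). Qed.

Lemma orientation_degree e o v : orientation e o ->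
  degree e v = (degree o v + #|[set u | o u v]|)%N.
Proof.
move=> oP; rewrite cardsE -sum1_card big_mkcond !degreeE -big_split /=.
by apply: eq_bigr => u _; rewrite -oP.
Qed.

Definition reverse_star o w A : rel T :=
  fun u x => (o u x && ~~ ((u \in A) && (x == w))) || ((u == w) && (x \in A)).

Lemma reverse_starP e o w A : irreflexive e -> orientation e o ->
    (forall u, u \in A -> o u w) ->
  orientation e (reverse_star o w A) /\
  forall u, (degree (reverse_star o w A) u + (u \in A)
             = degree o u + (u == w) * #|A|)%N.
Proof.
move=> irr oP Aw.
(* This arcwise balance, free of subtraction, gives both claims: add it for the two directions of a
   pair, or sum it over [x]. *)
have arcE u x : (reverse_star o w A u x + ((u \in A) && (x == w))
                 = o u x + ((u == w) && (x \in A)))%N.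
  have := oP u x; rewrite /reverse_star.
  have [->|neq_xw] := eqVneq x w; last first.
    have [->|] := eqVneq u w; last by rewrite andbF; case: (o u x).
    case xA: (x \in A); last by rewrite andbF; case: (o w x).
    by rewrite (Aw _ xA) andbF; case: (o w x) (e w x) => [] [].
  have [->|] := eqVneq u w.
    rewrite (orientation_irr irr oP).
    by case wA: (w \in A) => //; have := Aw _ wA; rewrite (orientation_irr irr oP).
  case uA: (u \in A); last by case: (o u w).
  by rewrite (Aw _ uA).
split=> [u x|u]; first by have := arcE u x; have := arcE x u; have := oP u x; lia.
have -> : ((u \in A) = \sum_x ((u \in A) && (x == w)) :> nat)%N.
  rewrite (bigD1 w) //= eqxx andbT big1 ?addn0 // => x /negbTE->.
  by rewrite andbF.
have -> : ((u == w) * #|A| = \sum_x ((u == w) && (x \in A)))%N.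
  rewrite -sum1_card big_mkcond big_distrr /=; apply: eq_bigr => x _.
  by case: (u == w); case: (x \in A).
by rewrite !degreeE -!big_split; apply: eq_bigr => x _; apply: arcE.
Qed.

(** Reverse the first arc as a star with [A = [set v]]. The rest of the path avoids [v], so it
    survives for the induction, and the changes at inner vertices cancel. *)
Lemma reverse_path e o v p : irreflexive e -> orientation e o ->
    path o v p -> uniq (v :: p) ->
  exists2 o', orientation e o' &
    forall u, (degree o' u + (u == v) = degree o u + (u == last v p))%N.
Proof.
move=> irr; elim: p v o => [|x p IHp] v o oP; first by exists o.
move=> /= /andP[ovx xp] /andP[vNxp uniq_xp].
have [|o1P deg1] := @reverse_starP e o x [set v] irr oP.
  by move=> u /set1P->.
have xp1 : path (reverse_star o x [set v]) x p.
  apply: (@sub_in_path _ (predC1 v) o) xp => [a b|].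
    rewrite !inE => /negbTE av _ oab.
    by rewrite /reverse_star !inE av oab.
  by apply/allP=> a ap; apply: contra vNxp => /eqP<-.
have [o' o'P deg'] := IHp x _ o1P xp1 uniq_xp.
exists o' => // u; have := deg' u; have := deg1 u.
by rewrite in_set1 cards1; lia.
Qed.

(** Both sides count the arcs inside [S], as no arc leaves it. *)
Lemma sum_indegree_closed o S :
    (forall u x, u \in S -> o u x -> x \in S) ->
  (\sum_(x in S) #|[set u in S | o u x]| = \sum_(u in S) degree o u)%N.
Proof.
move=> closedS.
under eq_bigr do rewrite -sum1dep_card big_mkcondr.
rewrite exchange_big /=; apply: eq_bigr => u uS.
rewrite degreeE big_mkcond /=; apply: eq_bigr => x _.
by case: (o u x) (closedS u x uS) => [/(_ isT)->|_] //; rewrite if_same.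
Qed.

(** * Target windows and the decreasing potential *)

Section Windows.
Variables (e : rel T) (lo hi : T -> int).
Hypotheses (irr_e : irreflexive e) (lt_lohi : forall v, lo v < hi v).
Hypotheses (deg_hi : forall v, (degree e v)%:Z <= 2 * hi v).
Hypotheses (hi_lo : forall v, hi v <= 2 * lo v + 4).

Let bot high v : int := if v \in high then hi v - 1 else lo v.
Let potential o high v : nat :=
  (absz (Num.max 0 ((degree o v)%:Z - (bot high v + 1)))%R + (v \notin high))%N.

Lemma promotable_vertex o high S v : orientation e o ->
    (forall u x, u \in S -> o u x -> x \in S) ->
    (forall x, x \in S -> bot high x + 1 <= (degree o x)%:Z) ->
    v \in S -> bot high v + 1 < (degree o v)%:Z ->
  exists2 w, w \in S :\: high &
    hi w - 1 <= (degree o w + #|[set u in S | o u w]|)%:Z.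
Proof.
move=> oP closedS topS vS topv; apply/exists_inP.
apply: contraT => /exists_inPn noW.
(* A high [x] has out-degree at least [hi x], hence at least half its degree. A low [x] has
   out-degree d at least [lo x + 1], and [noW] bounds its in-degree from [S] by [hi x - 2 - d],
   which is at most [2 * lo x + 2 - d] and so at most d. The excess at [v] makes the bound strict
   there. *)
have in_out x : x \in S -> (#|[set u in S | o u x]| <= degree o x)%N /\
    (x = v -> (#|[set u in S | o u x]| < degree o x)%N).
  move=> xS; have := topS x xS.
  have topx : x = v -> bot high x + 1 < (degree o x)%:Z by move->.
  have := noW x; rewrite inE xS andbT.
  have := orientation_degree x oP; have := deg_hi x; have := hi_lo x.
  have : (#|[set u in S | o u x]| <= #|[set u | o u x]|)%N.
    by apply/subset_leq_card/subsetP=> u; rewrite !inE => /andP[].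
  move: topx; rewrite /bot; case: (x \in high) => /= topx.
    by move=> *; split; [lia | move/topx; lia].
  by move=> ? ? ? ? /(_ isT) ? ?; split; [lia | move/topx; lia].
have : (\sum_(x in S) #|[set u in S | o u x]| < \sum_(x in S) degree o x)%N.
  rewrite (bigD1 v) //= [X in (_ < X)%N](bigD1 v) //= -addSn.
  apply: leq_add; first exact: (in_out v vS).2.
  by apply: leq_sum => x /andP[/in_out[]].
by rewrite sum_indegree_closed // ltnn.
Qed.

Lemma potential_decrease o high v : orientation e o ->
    (forall x, bot high x <= (degree o x)%:Z) ->
    bot high v + 1 < (degree o v)%:Z ->
  exists o' high', [/\ orientation e o',
    forall x, bot high' x <= (degree o' x)%:Z &
    (\sum_x potential o' high' x < \sum_x potential o high x)%N].
Proof.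
move=> oP botP topv.
have sum_lt o' high' w :
    (forall x, (potential o' high' x <= potential o high x)%N) ->
    (potential o' high' w < potential o high w)%N ->
    (\sum_x potential o' high' x < \sum_x potential o high x)%N.
  move=> le_pot lt_w; rewrite (bigD1 w) //= [X in (_ < X)%N](bigD1 w) //=.
  by rewrite -addSn leq_add // leq_sum.
pose S := [set x | connect o v x].
have vS : v \in S by rewrite inE connect0.
have closedS u x : u \in S -> o u x -> x \in S.
  by rewrite !inE => vu ux; apply: connect_trans vu (connect1 ux).
case: (boolP [forall x in S, bot high x + 1 <= (degree o x)%:Z]); last first.
  case/forall_inPn=> w; rewrite inE => /connectP[p0 p0P wE] topw.
  case/shortenP: p0P wE => p pP uniq_p _ wE.
  have [o' o'P] := reverse_path irr_e oP pP uniq_p; rewrite -wE => deg'.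
  have neq_vw : v != w by apply: contraNneq topw => <-; lia.
  exists o', high; split=> // [x|].
    by have := deg' x; have := botP x; have [->|_] := eqVneq x v; lia.
  apply: (sum_lt _ _ v) => [x|].
    have := deg' x; rewrite /potential.
    have [->|_] := eqVneq x v; first by lia.
    by have [->|_] := eqVneq x w; lia.
  by have := deg' v; rewrite /potential eqxx (negbTE neq_vw); lia.
move/forall_inP=> topS.
have [w /setDP[wS wNhigh] gew] := promotable_vertex oP closedS topS vS topv.
(* The shortfall of [w] from its new bottom [hi w - 1], or 0 if there is none. *)
pose k := absz (Num.max 0 (hi w - 1 - (degree o w)%:Z)).
have : (k <= #|[set u in S | o u w]|)%N by rewrite /k; lia.
case/card_geqP=> s [uniq_s size_s sub_s].
pose A := [set u in s].
have cardA : #|A| = k by rewrite cardsE -size_s; apply/card_uniqP.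
have AP u : u \in A -> u \in S /\ o u w.
  by rewrite inE => /sub_s; rewrite inE => /andP[].
have [|o'P deg'] := @reverse_starP e o w A irr_e oP; first by move=> u /AP[].
have wNA : w \notin A.
  by apply/negP => /AP[_]; rewrite (orientation_irr irr_e oP).
exists (reverse_star o w A), (w |: high); split=> // [x|].
  have := deg' x; have := botP x; rewrite cardA /bot in_setU1 /k.
  have [->|_] := eqVneq x w; first by rewrite (negbTE wNA) /=; lia.
  case xA: (x \in A) => /=; last by case: (x \in high); lia.
  (* Tails in [A] reach the top of their windows, so they can lose one arc. *)
  by have := topS x (AP _ xA).1; rewrite /bot; case: (x \in high); lia.
(* The excess at [w] does not grow, since its new top [hi w] is at least [lo w + 1]; the term for
   being low disappears. *)
have lt_w : (potential (reverse_star o w A) (w |: high) w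
             < potential o high w)%N.
  have := deg' w; have := lt_lohi w.
  rewrite cardA /potential /bot setU11 (negbTE wNhigh) (negbTE wNA) eqxx /k /=.
  by lia.
apply: (sum_lt _ _ w) => // x.
have [->|neq_xw] := eqVneq x w; first exact: ltnW.
have := deg' x; rewrite /potential /bot in_setU1 (negbTE neq_xw) /=.
by case: (x \in A); case: (x \in high); lia.
Qed.

Lemma windowed_orientation o : orientation e o ->
    (forall v, lo v <= (degree o v)%:Z) ->
  exists2 o', orientation e o' &
    forall v, (degree o' v)%:Z \in [:: lo v; lo v + 1; hi v - 1; hi v].
Proof.
move=> oP loP.
have : forall v, bot set0 v <= (degree o v)%:Z by move=> v; rewrite /bot inE.
(* The induction must allow any [high], since promotions enlarge it. *)
move: (set0 : {set T}) => high.
have [n] := ubnP (\sum_v potential o high v)%N.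
elim: n o high oP {loP} => // n IHn o high oP le_n botP.
case: (boolP [forall v, (degree o v)%:Z <= bot high v + 1]) => [/forallP top|].
  exists o => // v; have := top v; have := botP v; rewrite /bot !inE.
  by case: (v \in high); lia.
case/forallPn=> v; rewrite -ltNge => /(potential_decrease oP botP).
case=> o' [high' [o'P bot' lt_pot]].
by apply: (IHn o' high') => //; apply: leq_trans lt_pot _.
Qed.

End Windows.

(** * Factors of a bipartite graph as orientations *)

Section Bipartite.
Variables (e : rel T) (X Y : {set T}).
Hypotheses (simple_e : simple_graph e) (bip : bipartition e X Y).

Lemma bipartition_in u v : e u v -> (v \in X) = (u \notin X).
Proof.
have [_ dXY /(_ u v) H] := bip => /H.
have XY x : x \in Y -> (x \in X) = false.
  by move=> xY; apply/negbTE; rewrite (disjointFl dXY xY).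
by case/orP=> /andP[ux vx]; [rewrite ux XY | rewrite vx XY].
Qed.

Lemma factor_orientation h : factor e h ->
  exists2 o, orientation e o & forall v,
    degree o v = if v \in X then degree h v else (degree e v - degree h v)%N.
Proof.
move=> [[symh _] sub_h].
exists (fun u v => if u \in X then h u v else e u v && ~~ h u v).
  move=> u v; case: (boolP (e u v)) => [euv|nuv].
    rewrite (bipartition_in euv) simple_e.1 euv symh.
    by case: (u \in X); case: (h v u).
  have := sub_h u v; rewrite (simple_e.1 v) (symh v) (negbTE nuv) /=.
  by case: (h u v) => [/(_ isT)|_] //; rewrite !if_same.
move=> v; rewrite /degree; case: ifP => // _.
have -> : [set w | e v w && ~~ h v w] = [set w | e v w] :\: [set w | h v w].
  by apply/setP=> w; rewrite !inE andbC.
rewrite cardsD (setIidPr _) //; apply/subsetP=> w; rewrite !inE; exact: sub_h.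
Qed.

Lemma orientation_factor o : orientation e o ->
  exists2 h, factor e h & forall v,
    degree h v = if v \in X then degree o v else (degree e v - degree o v)%N.
Proof.
move=> oP.
have oe u v : o u v -> e u v by have := oP u v; case: (o u v) (e u v) => [] [] //; lia.
exists (fun u v => if u \in X then o u v else o v u); last first.
  move=> v; rewrite (orientation_degree v oP) addKn /degree.
  by case: (v \in X).
have sub_e u v : (if u \in X then o u v else o v u) -> e u v.
  by case: ifP => _ /oe //; rewrite simple_e.1.
split=> //; split=> [u v|u]; last first.
  by rewrite if_same (orientation_irr simple_e.2 oP).
case: (boolP (e u v)) => [euv|nuv].
  by rewrite (bipartition_in euv); case: (u \in X).
by apply/idP/idP=> /sub_e; rewrite ?[e v u]simple_e.1 (negbTE nuv).
Qed.

End Bipartite.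
End Orientations.

(** * Integer forms of the bounds and the theorem *)

Lemma ler_half_int (m n : int) : (m%:Q / 2 <= n%:Q) = (m <= 2 * n).
Proof. by rewrite ler_pdivrMr // -[2]/(2%:~R) -intrM ler_int mulrC. Qed.

Lemma factor_degree_le (T : finType) (e h : rel T) (v : T) :
  factor e h -> (degree h v <= degree e v)%N.
Proof.
move=> [_ sub]; apply/subset_leq_card/subsetP=> w; rewrite !inE; exact: sub.
Qed.

Theorem theorem3p3 (T : finType) (e : rel T) (X Y : {set T}) (g f : T -> int)
  (simpleG : simple_graph e)
  (bipG : bipartition e X Y)
  (lt_gf : forall v : T, g v < f v)
  (hX : forall v : T, v \in X ->
     (degree e v)%:Q / 2 <= (f v)%:Q /\ (f v)%:Q / 2 - 2 <= (g v)%:Q)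
  (hY : forall v : T, v \in Y ->
     (g v)%:Q <= (degree e v)%:Q / 2 /\
     (f v)%:Q <= ((degree e v)%:Q + (g v)%:Q) / 2 + 2) :
  (exists2 h : rel T, factor e h &
     forall v : T, g v <= (degree h v)%:Z <= f v)
  <->
  (exists2 h : rel T, factor e h &
     forall v : T, (degree h v)%:Z \in [:: g v; g v + 1; f v - 1; f v]).
Proof.
split=> [] [h hP degh]; last first.
  exists h => // v; have := degh v; have := lt_gf v; rewrite !inE; lia.
have X_or_Y v : v \notin X -> v \in Y.
  have [XY _ _] := bipG; have : v \in X :|: Y by rewrite XY.
  by rewrite inE => /orP[->|].
have boundX v : v \in X -> (degree e v)%:Z <= 2 * f v /\ f v <= 2 * g v + 4.
  move=> /hX[]; rewrite ler_half_int => ? {}hX; split=> //.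
  have -> : 2 * g v + 4 = 2 * (g v + 2) by rewrite mulrDr.
  by rewrite -ler_half_int intrD -lerBlDr.
have boundY v : v \in Y ->
    2 * g v <= (degree e v)%:Z /\ 2 * f v <= (degree e v)%:Z + g v + 4.
  move=> /hY[]; rewrite -[(f v)%:~R <= _]lerBlDr !ler_pdivlMr //.
  rewrite -[2]/(2%:~R) -intrB -!intrM -intrD !ler_int.
  by move=> ? ?; split; lia.
(* On [Y] the out-degree is the degree in the complement of the factor, so [f] and [g] swap
   roles. *)
pose lo v := if v \in X then g v else (degree e v)%:Z - f v.
pose hi v := if v \in X then f v else (degree e v)%:Z - g v.
have [o oP dego] := factor_orientation simpleG bipG hP.
have [||||o' o'P dego'] :=
  @windowed_orientation T e lo hi simpleG.2 _ _ _ o oP.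
- by move=> v; have := lt_gf v; rewrite /lo /hi; case: ifP => _; lia.
- move=> v; rewrite /hi; case: ifPn => [/boundX|/X_or_Y/boundY]; lia.
- move=> v; rewrite /hi /lo; case: ifPn => [/boundX|/X_or_Y/boundY]; lia.
- move=> v; rewrite /lo dego; have := degh v; have := factor_degree_le v hP.
  by case: ifP => _; lia.
have [h' h'P degh'] := orientation_factor simpleG bipG o'P.
exists h' => // v; rewrite degh'; have := dego' v.
have := orientation_degree v o'P.
(* On [Y], complementing in [degree e v] sends [lo, lo + 1, hi - 1, hi] to [f, f - 1, g + 1, g]. *)
by rewrite /lo /hi; case: ifP => _ //; rewrite !inE; lia.
Qed.
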